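(* Let $k$ be an algebraically closed field of characteristic $p\ne 3$. For each $r\ge 2$, we have $\dim C_r(\mathfrak{gl}_3)=3r+6$.
   Context: $C_r(\mathfrak{gl}_3)$ is the closed subvariety of $\mathfrak{gl}_3(k)^r$ of all $r$-tuples $(v_1,\ldots,v_r)$ of $3\times 3$ matrices over $k$ with $[v_i,v_j]=0$ for all $i,j$. *)

(* Defs.v *)
From HB Require Import structures.
From mathcomp Require Import all_boot all_order all_algebra.
From mathcomp Require Import mpoly.
From mathcomp Require Import classical_sets.
Set Implicit Arguments. Unset Strict Implicit. Unset Printing Implicit Defensive.
Import GRing.Theory.
Local Open Scope ring_scope.
Local Open Scope classical_set_scope.

(* Affine space A^N over k is 'rV[k]_N, with coordinate functions
   x |-> x 0 i, so a polynomial p takes the value p.@[x 0] at x. *)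
Definition zero_locus (k : fieldType) (N : nat) (S : set {mpoly k[N]}) :
    set 'rV[k]_N :=
  [set x : 'rV[k]_N | forall p, S p -> p.@[x 0] = 0].

(* Closed subsets of X for the Zariski topology induced from A^N. *)
Definition zariski_closed_in (k : fieldType) (N : nat)
    (X Z : set 'rV[k]_N) : Prop :=
  exists S : set {mpoly k[N]}, Z = X `&` zero_locus S.

Definition zariski_irreducible (k : fieldType) (N : nat)
    (Z : set 'rV[k]_N) : Prop :=
  Z !=set0 /\
  forall A B : set 'rV[k]_N,
    zariski_closed_in Z A -> zariski_closed_in Z B ->
    Z = A `|` B -> Z = A \/ Z = B.

(* X contains a chain Z 0 < Z 1 < ... < Z d; only Z 0, ..., Z d matter. *)
Definition has_irreducible_chain (k : fieldType) (N : nat)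
    (X : set 'rV[k]_N) (d : nat) : Prop :=
  exists Z : nat -> set 'rV[k]_N,
    (forall i, (i <= d)%N ->
       zariski_closed_in X (Z i) /\ zariski_irreducible (Z i)) /\
    (forall i, (i < d)%N -> Z i `<` Z i.+1).

(* Krull dimension, as a functional relation: no d satisfies it when X is
   empty. *)
Definition zariski_dim (k : fieldType) (N : nat) (X : set 'rV[k]_N)
    (d : nat) : Prop :=
  has_irreducible_chain X d /\
  forall m, has_irreducible_chain X m -> (m <= d)%N.

Definition lie_bracket (k : fieldType) (n : nat) (A B : 'M[k]_n) : 'M[k]_n :=
  A *m B - B *m A.

(* gl_n(k)^r is identified with A^(r * (n * n)) by listing all entries: the
   point x stands for the r-tuple of n x n matrices tuple_mx x. *)
Definition tuple_mx (k : fieldType) (r n : nat) (x : 'rV[k]_(r * (n * n)))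
    (i : 'I_r) : 'M[k]_n :=
  vec_mx (row i (vec_mx x)).

Definition commuting_variety (k : fieldType) (r n : nat) :
    set 'rV[k]_(r * (n * n)) :=
  [set x | forall i j : 'I_r, lie_bracket (tuple_mx x i) (tuple_mx x j) = 0].
Arguments commuting_variety k r n : clear implicits.

(* Main.v *)
(* Lower bound: choosing any matrix v_0 and quadratic polynomials in v_0 as the
   other entries gives 9 + 3(r - 1) = 3r + 6 parameters; releasing them one at a
   time gives a chain of closures of polynomial images, each irreducible because
   two nonzero polynomials do not vanish simultaneously everywhere on a line.

   Upper bound: in a chain Z_0 < ... < Z_m of irreducible closed sets, polynomials
   f_j vanishing on Z_j but not on Z_(j+1) are algebraically independent on Z_m,
   while on the image of a polynomial map from k^d any m > d polynomials are
   dependent, by counting monomials.  It remains to cover the commuting tuples by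
   such images with d <= 3r + 6.  If some combination of the v_i has a cyclic
   vector, the tuple is a limit of tuples of the first kind.  Otherwise each v_i
   is a scalar plus a matrix of rank at most one, and any two of these rank one
   parts share their image or their kernel; hence either they are all
   proportional (2r + 6 parameters), or they share a line g = p x q as image, with
   functionals a_i p + b_i q vanishing on g (3r + 6 parameters), or dually. *)
Require Import Defs.
From mathcomp Require Import all_boot all_order all_algebra.
From mathcomp Require Import classical_sets.
From mathcomp Require Import mpoly boolp ring zify.
Set Implicit Arguments. Unset Strict Implicit. Unset Printing Implicit Defensive.
Import GRing.Theory.
Local Open Scope ring_scope.

(** * Polynomial functions of parameters, and matrices depending polynomially on them *)

Section PolynomialFunctions.
Variable k : fieldType.

(** Closure rules let structured types index the parameters without numbering them, and make
    substitution a plain induction. *)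
Inductive polyfun (I : Type) : ((I -> k) -> k) -> Prop :=
| polyfun_const c : polyfun (fun=> c)
| polyfun_var i : polyfun (fun t => t i)
| polyfun_add f g : polyfun f -> polyfun g -> polyfun (fun t => f t + g t)
| polyfun_mul f g : polyfun f -> polyfun g -> polyfun (fun t => f t * g t).

Lemma polyfun_sub I (f g : (I -> k) -> k) :
  polyfun f -> polyfun g -> polyfun (fun t => f t - g t).
Proof.
move=> pf pg; have -> : (fun t => f t - g t) = (fun t => f t + -1 * g t).
  by apply/funext => t; rewrite mulN1r.
by apply: polyfun_add => //; apply: polyfun_mul => //; apply: polyfun_const.
Qed.

Lemma polyfun_sum I (J : Type) (s : seq J) (P : pred J)
    (F : J -> (I -> k) -> k) :
  (forall j, polyfun (F j)) -> polyfun (fun t => \sum_(j <- s | P j) F j t).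
Proof.
move=> pF; elim: s => [|j s IH].
  have -> : (fun t => \sum_(j <- [::] | P j) F j t) = (fun=> 0).
    by apply/funext => t; rewrite big_nil.
  exact: polyfun_const.
have -> : (fun t => \sum_(i <- j :: s | P i) F i t) =
    (fun t => (if P j then F j t else 0) + \sum_(i <- s | P i) F i t).
  by apply/funext => t; rewrite big_cons; case: (P j); rewrite ?add0r.
by apply: polyfun_add => //; case: (P j) => //; apply: polyfun_const.
Qed.

Lemma polyfun_prod I (J : Type) (s : seq J) (F : J -> (I -> k) -> k) :
  (forall j, polyfun (F j)) -> polyfun (fun t => \prod_(j <- s) F j t).
Proof.
move=> pF; elim: s => [|j s IH].
  have -> : (fun t => \prod_(j <- [::]) F j t) = (fun=> 1).
    by apply/funext => t; rewrite big_nil.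
  exact: polyfun_const.
have -> : (fun t => \prod_(i <- j :: s) F i t) =
    (fun t => F j t * \prod_(i <- s) F i t).
  by apply/funext => t; rewrite big_cons.
exact: polyfun_mul.
Qed.

Lemma polyfun_exp I (f : (I -> k) -> k) n :
  polyfun f -> polyfun (fun t => f t ^+ n).
Proof.
move=> pf; elim: n => [|n IH]; first exact: polyfun_const.
have -> : (fun t => f t ^+ n.+1) = (fun t => f t * f t ^+ n).
  by apply/funext => t; rewrite exprS.
exact: polyfun_mul.
Qed.

Lemma polyfun_comp I J (f : (I -> k) -> k) (s : (J -> k) -> I -> k) :
  polyfun f -> (forall i, polyfun (fun t => s t i)) ->
  polyfun (fun t => f (s t)).
Proof.
move=> pf ps; elim: pf => [c|i|g h _ IHg _ IHh|g h _ IHg _ IHh] //.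
- exact: polyfun_const.
- exact: polyfun_add.
- exact: polyfun_mul.
Qed.

Lemma polyfun_meval I N (p : {mpoly k[N]}) (x : (I -> k) -> 'rV[k]_N) :
  (forall i, polyfun (fun t => x t 0 i)) -> polyfun (fun t => p.@[x t 0]).
Proof.
move=> px; have -> : (fun t => p.@[x t 0]) =
    (fun t => \sum_(m <- msupp p) p@_m * \prod_i x t 0 i ^+ m i).
  by apply/funext => t; rewrite mevalE.
apply: polyfun_sum => m; apply: polyfun_mul; first exact: polyfun_const.
by apply: polyfun_prod => i; apply: polyfun_exp.
Qed.

Definition polymx I m n (A : (I -> k) -> 'M[k]_(m, n)) : Prop :=
  forall i j, polyfun (fun t => A t i j).

Lemma polymx_const I m n (A : 'M[k]_(m, n)) : polymx (fun _ : I -> k => A).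
Proof. by move=> i j; apply: polyfun_const. Qed.

Lemma polymx_add I m n (A B : (I -> k) -> 'M[k]_(m, n)) :
  polymx A -> polymx B -> polymx (fun t => A t + B t).
Proof.
move=> pA pB i j; rewrite (_ : (fun _ => _) = (fun t => A t i j + B t i j)).
  exact: polyfun_add.
by apply/funext => t; rewrite mxE.
Qed.

Lemma polymx_sum I m n (J : finType) (A : J -> (I -> k) -> 'M[k]_(m, n)) :
  (forall l, polymx (A l)) -> polymx (fun t => \sum_l A l t).
Proof.
move=> pA i j; rewrite (_ : (fun _ => _) = (fun t => \sum_l A l t i j)).
  by apply: polyfun_sum => l; apply: pA.
by apply/funext => t; rewrite summxE.
Qed.

Lemma polymx_scale I m n (f : (I -> k) -> k) (A : (I -> k) -> 'M[k]_(m, n)) :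
  polyfun f -> polymx A -> polymx (fun t => f t *: A t).
Proof.
move=> pf pA i j; rewrite (_ : (fun _ => _) = (fun t => f t * A t i j)).
  exact: polyfun_mul.
by apply/funext => t; rewrite mxE.
Qed.

Lemma polymx_scalar I n (f : (I -> k) -> k) :
  polyfun f -> polymx (fun t => (f t)%:M : 'M[k]_n).
Proof.
move=> pf i j; rewrite (_ : (fun _ => _) = (fun t => f t * (i == j)%:R)).
  by apply: polyfun_mul => //; apply: polyfun_const.
by apply/funext => t; rewrite mxE mulr_natr.
Qed.

Lemma polymx_mul I m n q (A : (I -> k) -> 'M[k]_(m, n))
    (B : (I -> k) -> 'M[k]_(n, q)) :
  polymx A -> polymx B -> polymx (fun t => A t *m B t).
Proof.
move=> pA pB i j.
rewrite (_ : (fun _ => _) = (fun t => \sum_l A t i l * B t l j)).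
  by apply: polyfun_sum => l; apply: polyfun_mul.
by apply/funext => t; rewrite mxE.
Qed.

Lemma polymx_tr I m n (A : (I -> k) -> 'M[k]_(m, n)) :
  polymx A -> polymx (fun t => (A t)^T).
Proof.
move=> pA i j; rewrite (_ : (fun _ => _) = (fun t => A t j i)) //.
by apply/funext => t; rewrite mxE.
Qed.

Lemma polymx_exp I n (A : (I -> k) -> 'M[k]_n.+1) e :
  polymx A -> polymx (fun t => A t ^+ e).
Proof.
move=> pA; elim: e => [|e IH]; first exact: polymx_const.
rewrite (_ : (fun _ => _) = (fun t => A t *m A t ^+ e)); first exact: polymx_mul.
by apply/funext => t; rewrite exprS.
Qed.

Lemma polyfun_univariate (f : (unit -> k) -> k) :
  polyfun f -> exists p : {poly k}, forall t, f t = p.[t tt].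
Proof.
elim=> [c|[]|g h _ [p Hp] _ [q Hq]|g h _ [p Hp] _ [q Hq]].
- by exists c%:P => t; rewrite hornerC.
- by exists 'X => t; rewrite hornerX.
- by exists (p + q) => t; rewrite hornerD Hp Hq.
- by exists (p * q) => t; rewrite hornerM Hp Hq.
Qed.

Lemma polyfun_mpoly (I : finType) (f : (I -> k) -> k) :
  polyfun f ->
  exists p : {mpoly k[#|I|]}, forall t, f t = p.@[fun i => t (enum_val i)].
Proof.
elim=> [c|i|g h _ [p Hp] _ [q Hq]|g h _ [p Hp] _ [q Hq]].
- by exists c%:MP => t; rewrite mevalC.
- by exists 'X_(enum_rank i) => t; rewrite mevalXU enum_rankK.
- by exists (p + q) => t; rewrite mevalD Hp Hq.
- by exists (p * q) => t; rewrite mevalM Hp Hq.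
Qed.

End PolynomialFunctions.

(** On the line joining [a] and [b] both functions become nonzero polynomials in one variable, whose
    product has a non-root over an algebraically closed field. *)
Lemma polyfun_identity (k : closedFieldType) I (f g : (I -> k) -> k) a b :
  polyfun f -> polyfun g -> f a != 0 -> g b != 0 ->
  exists t, f t != 0 /\ g t != 0.
Proof.
move=> pf pg fa gb.
pose line (t : unit -> k) i := a i + t tt * (b i - a i).
have pline i : polyfun (fun t => line t i).
  apply: polyfun_add; first exact: polyfun_const.
  by apply: polyfun_mul; [apply: polyfun_var | apply: polyfun_const].
have [p Hp] := polyfun_univariate (polyfun_comp pf pline).
have [q Hq] := polyfun_univariate (polyfun_comp pg pline).
have l0 : line (fun=> 0) = a by apply/funext => i; rewrite /line mul0r addr0.
have l1 : line (fun=> 1) = b.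
  by apply/funext => i; rewrite /line mul1r addrC subrK.
have p0 : p != 0.
  by apply: contraNneq fa => p0; rewrite -l0 Hp p0 horner0.
have q0 : q != 0.
  by apply: contraNneq gb => q0; rewrite -l1 Hq q0 horner0.
have /closed_nonrootP[s] : p * q != 0 by rewrite mulf_neq0.
rewrite rootE hornerM mulf_eq0 negb_or => /andP[ps qs].
by exists (line (fun=> s)); rewrite Hp Hq.
Qed.

(** * Algebraic dependence by counting monomials *)

Fixpoint box (D m : nat) : finType :=
  if m is m'.+1 then ('I_D * box D m')%type else unit.

(** The last variable is the outermost factor, so that an induction on [m] can split off its
    powers. *)
Fixpoint monomial (R : comNzRingType) (f : nat -> R) (D m : nat) :
    box D m -> R :=
  if m is m'.+1 then fun a : box D m'.+1 => f m' ^+ a.1 * monomial f a.2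
  else fun=> 1.

Lemma card_box D m : #|box D m| = (D ^ m)%N.
Proof.
elim: m => [|m IH]; first by rewrite card_unit expn0.
by rewrite /= card_prod card_ord IH expnS.
Qed.

Lemma rmorph_monomial (R S : comNzRingType) (h : {rmorphism R -> S})
    (f : nat -> R) D m (a : box D m) :
  h (monomial f a) = monomial (h \o f) a.
Proof.
elim: m a => [|m IH] a /=; first by rewrite rmorph1.
by rewrite rmorphM rmorphXn IH.
Qed.

Section AlgebraicDependence.
Variable k : fieldType.

Lemma card_bounded_multinom n K : (#|{: 'X_{1..n < K}}| <= K ^ n)%N.
Proof.
have bound (b : 'X_{1..n < K}) (i : 'I_n) : (bmnm b i < K)%N.
  by apply: leq_ltn_trans (bmdeg b); rewrite mdegE (bigD1 i) //= leq_addr.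
pose code (b : 'X_{1..n < K}) := [ffun i => Ordinal (bound b i)].
have code_inj : injective code.
  move=> b c /ffunP bc; apply/val_inj/mnmP => i.
  by have := bc i; rewrite !ffunE => /(congr1 val).
by have := leq_card code code_inj; rewrite card_ffun !card_ord.
Qed.

Definition degree_le n (p : {mpoly k[n]}) (e : nat) := (msize p <= e.+1)%N.

Lemma degree_le_mul n (p q : {mpoly k[n]}) d e :
  degree_le p d -> degree_le q e -> degree_le (p * q) (d + e).
Proof.
rewrite /degree_le => pd qe.
have [->|p0] := eqVneq p 0; first by rewrite mul0r msize0.
have [->|q0] := eqVneq q 0; first by rewrite mulr0 msize0.
by rewrite msizeM //; move: (mmeasure _ p) (mmeasure _ q) pd qe => a b; lia.
Qed.

Lemma degree_le_exp n (p : {mpoly k[n]}) e a :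
  degree_le p e -> degree_le (p ^+ a) (a * e).
Proof.
move=> pe; elim: a => [|a IH]; first by rewrite /degree_le expr0 msize1.
by rewrite exprS mulSn; apply: degree_le_mul.
Qed.

Lemma degree_le_monomial n (p : nat -> {mpoly k[n]}) e D m (a : box D m) :
  (forall j, (j < m)%N -> degree_le (p j) e) ->
  degree_le (monomial p a) (m * (D * e)).
Proof.
elim: m a => [|m IH] a pe; first by rewrite /degree_le msize1.
rewrite mulSn; apply: degree_le_mul; last by apply: IH => j /ltnW; apply: pe.
have := degree_le_exp a.1 (pe m (leqnn _)).
rewrite /degree_le => /leq_trans; apply.
by rewrite ltnS leq_mul2r ltnW ?orbT.
Qed.

(* Counting: with exponents below [D], the [D ^ m] monomials in the [p j] lie
   in a space of dimension at most [(m * (D * e)).+1 ^ n = O(D ^ n)]. *)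
Lemma mpoly_dependence n m (p : nat -> {mpoly k[n]}) : (n < m)%N ->
  exists D, exists c : box D m -> k, (exists a, c a != 0) /\
    \sum_a c a *: monomial p a = 0.
Proof.
move=> lt_nm; pose e := (\max_(j < m) msize (p j))%N.
have pe j : (j < m)%N -> degree_le (p j) e.
  by move=> jm; apply: leqW; rewrite (bigmax_sup (Ordinal jm)).
(* [D] exceeds [(m * e).+1 ^ n], so [K <= D * (m * e).+1] yields [K ^ n < D ^ n.+1 <= D ^ m]. *)
pose D := ((m * e).+1 ^ n).+1; pose K := (m * (D * e)).+1; exists D.
have lt_KD : (#|{: 'X_{1..n < K}}| < #|box D m|)%N.
  apply: leq_ltn_trans (card_bounded_multinom n K) _; rewrite card_box.
  have leK : (K <= D * (m * e).+1)%N by rewrite /K mulnCA mulnS -add1n leq_add2r.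
  have := leq_pexp2l (ltn0Sn ((m * e).+1 ^ n)) lt_nm.
  apply: leq_trans; rewrite -/D expnS mulnC.
  apply: leq_ltn_trans (_ : D ^ n * (m * e).+1 ^ n < _)%N.
    by rewrite -expnMn; case: (n) => // n'; rewrite leq_exp2r.
  by rewrite ltn_pmul2l // expn_gt0.
(* Each row lists the coefficients of one monomial in the [p j]; with more rows than columns, a
   nonzero left kernel vector exists and is the relation. *)
pose M := \matrix_(i < #|box D m|, j < #|{: 'X_{1..n < K}}|)
  (monomial p (enum_val i))@_(bmnm (enum_val j)).
have : kermx M != 0.
  rewrite -mxrank_eq0 mxrank_ker -lt0n subn_gt0.
  exact: leq_ltn_trans (rank_leq_col M) lt_KD.
case/rowV0Pn => v /sub_kermxP vM v0.
exists (fun a => v 0 (enum_rank a)); split.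
  case/rV0Pn: v0 => i vi; exists (enum_val i); by rewrite enum_valK.
apply/mpolyP => b; rewrite raddf_sum mcoeff0 /=.
have [bK|Kb] := ltnP (mdeg b) K.
  have := congr1 (fun A : 'M_(_, _) => A 0 (enum_rank (BMultinom bK))) vM.
  rewrite !mxE (reindex _ (onW_bij _ (enum_rank_bij _))) /= => vM0; rewrite -[RHS]vM0.
  by apply: eq_bigr => a _; rewrite mcoeffZ mxE !enum_rankK.
apply: big1 => a _; rewrite mcoeffZ memN_msupp_eq0 ?mulr0 //.
by apply: msize_mdeg_ge; apply: leq_trans Kb; apply: degree_le_monomial.
Qed.

Lemma polyfun_dependence (I : finType) m (f : nat -> (I -> k) -> k) :
  (forall j, polyfun (f j)) -> (#|I| < m)%N ->
  exists D, exists c : box D m -> k, (exists a, c a != 0) /\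
    forall t, \sum_a c a * monomial (fun j => f j t) a = 0.
Proof.
move=> pf ltm; have [p Hp] := choice (fun j => polyfun_mpoly (pf j)).
have [D [c [c0 cp]]] := mpoly_dependence p ltm.
exists D, c; split=> // t.
have := congr1 (meval (fun i => t (enum_val i))) cp.
rewrite raddf0 raddf_sum /= => cp_t; rewrite -[RHS]cp_t; apply: eq_bigr => a _.
rewrite mevalZ rmorph_monomial; congr (_ * monomial _ a).
by apply/funext => j /=; rewrite Hp.
Qed.

End AlgebraicDependence.

(** * Upper bounds for the length of chains of irreducible sets *)

Section ZariskiDimension.
Variables (k : fieldType) (N : nat).
Local Open Scope classical_set_scope.
Implicit Types (S X Z : set 'rV[k]_N) (p q : {mpoly k[N]}).

Definition vanish S p : Prop := forall x, S x -> p.@[x 0] = 0.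

Lemma vanishS S S' p : S `<=` S' -> vanish S' p -> vanish S p.
Proof. by move=> sub vp x /sub/vp. Qed.

(** The zero loci of [p] and [q] cut out two closed subsets covering [Z], so one of them is all of
    [Z]: the vanishing ideal is prime. *)
Lemma irreducible_prime Z p q : zariski_irreducible Z ->
  vanish Z (p * q) -> vanish Z p \/ vanish Z q.
Proof.
case=> _ irrZ vpq.
have closed (s : {mpoly k[N]}) : zariski_closed_in Z (Z `&` zero_locus [set s]).
  by exists [set s].
have cover : Z = (Z `&` zero_locus [set p]) `|` (Z `&` zero_locus [set q]).
  apply/seteqP; split=> [x Zx|x [] []//]; have := vpq x Zx.
  rewrite mevalM => /eqP; rewrite mulf_eq0 => /orP[] /eqP v0.
    by left; split=> // _ ->.
  by right; split=> // _ ->.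
by case: (irrZ _ _ (closed p) (closed q) cover) => ->; [left|right];
  move=> x [_]; apply.
Qed.

(** If [p] vanishes on [S1] but not on [Z], then for every [q] vanishing on [S2] the product
    vanishes on [Z], and primality gives [q]. Comparing ideals allows [Z] to lie only in the closure
    of the union. *)
Lemma irreducible_union Z S1 S2 : zariski_irreducible Z ->
  (forall p, vanish (S1 `|` S2) p -> vanish Z p) ->
  (forall p, vanish S1 p -> vanish Z p) \/ (forall p, vanish S2 p -> vanish Z p).
Proof.
move=> irrZ sub; case: (pselect (forall p, vanish S1 p -> vanish Z p)) => [|n1].
  by left.
right=> q v2; have [p [v1 np]] : exists p, vanish S1 p /\ ~ vanish Z p.
  by move/existsNP: n1 => [p /not_implyP[v1 np]]; exists p.
have : vanish Z (p * q).
  by apply: sub => x [/v1|/v2]; rewrite mevalM => ->; rewrite ?mul0r ?mulr0.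
by case/(irreducible_prime irrZ).
Qed.

(* The constant coefficient of [Q] vanishes on [Z], hence is [0]; primality then
   allows division by [g], and one iterates. *)
Lemma horner_vanish Z Z' (g : {mpoly k[N]}) (Q : {poly {mpoly k[N]}}) :
  zariski_irreducible Z' -> Z `<=` Z' -> vanish Z g -> ~ vanish Z' g ->
  (forall i, vanish Z Q`_i -> Q`_i = 0) -> vanish Z' Q.[g] -> Q = 0.
Proof.
move=> irrZ' sub vg ng; elim/poly_ind: Q => [|Q c IH] coefs vQ //.
have coef0 : (Q * 'X + c%:P)`_0 = c by rewrite coefD coefMX coefC add0r.
have c0 : c = 0.
  rewrite -coef0; apply: (coefs 0) => x Zx; rewrite coef0.
  have := vQ x (sub x Zx).
  by rewrite hornerD hornerMX hornerC mevalD mevalM vg // mulr0 add0r.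
move: coefs vQ; rewrite c0 addr0 => coefs vQ.
rewrite IH ?mul0r // => [i|].
  by have := coefs i.+1; rewrite coefMX.
by move: vQ; rewrite hornerMX => /(irreducible_prime irrZ')[].
Qed.

(** Induction on the length: a relation is sorted by powers of the last polynomial into a [Q] whose
    coefficients involve only the earlier ones. A coefficient vanishing on the previous set is zero
    by induction, as [horner_vanish] requires to conclude [Q = 0]. *)
Lemma chain_independence (Z : nat -> set 'rV[k]_N) (f : nat -> {mpoly k[N]})
    D m (c : box D m -> k) :
  (forall j, (j <= m)%N -> zariski_irreducible (Z j)) ->
  (forall j, (j < m)%N ->
     [/\ Z j `<=` Z j.+1, vanish (Z j) (f j) & ~ vanish (Z j.+1) (f j)]) ->
  vanish (Z m) (\sum_a c a *: monomial f a) -> forall a, c a = 0.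
Proof.
elim: m c => [|m IH] c irrZ step vc a.
  case: (irrZ 0 (leqnn _)) => -[x Zx] _; have := vc x Zx.
  rewrite (bigD1 (tt : box D 0)) //= big1 => [|[]//].
  by rewrite addr0 mevalZ meval1 mulr1; case: a.
have [sub vf nf] := step m (leqnn _).
have {}IH := IH _ (fun j jm => irrZ j (leqW jm)) (fun j jm => step j (leqW jm)).
(* Polynomial coefficients are indexed by [nat]; [insub] recovers the exponent in ['I_D], with value
   0 outside. *)
pose g i := \sum_(b : box D m) (if insub i is Some i' then c (i', b) else 0)
  *: monomial f b.
pose Q := \poly_(i < D) g i.
have Q0 : Q = 0.
  apply: (horner_vanish (irrZ _ (leqnn _)) sub vf nf) => [i|].
    rewrite coef_poly; case: ifP => // iD vg; apply: big1 => b _.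
    by rewrite (IH _ vg) scale0r.
  move=> x Zx; rewrite -[RHS](vc x Zx); congr (_.@[_]).
  transitivity (\sum_(i < D) \sum_b c (i, b) *: (f m ^+ i * monomial f b));
    last by rewrite pair_bigA; apply: eq_bigr => -[].
  rewrite horner_poly; apply: eq_bigr => i _; rewrite /g mulr_suml; apply: eq_bigr => b _.
  by rewrite valK -scalerAl mulrC.
case: a => i b; have := congr1 (fun P : {poly _} => P`_i) Q0.
rewrite coef_poly ltn_ord coef0 => gi0.
have := IH (fun b => c (i, b)); apply => x Zx.
by have := congr1 (meval (x 0)) gi0; rewrite meval0 /g valK.
Qed.

(** In terms of explicit relations: the algebra of polynomial functions on [S] has transcendence
    degree at most [d]. *)
Definition trdeg_le d S : Prop := forall m (f : nat -> {mpoly k[N]}),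
  (d < m)%N -> exists D, exists c : box D m -> k,
    (exists a, c a != 0) /\ vanish S (\sum_a c a *: monomial f a).

Lemma trdeg_le_range d (I : finType) (phi : (I -> k) -> 'rV[k]_N) S :
  polymx phi -> (#|I| <= d)%N -> S `<=` range phi -> trdeg_le d S.
Proof.
move=> pphi Id sub m f dm.
have [D [c [c0 cf]]] := polyfun_dependence
  (fun j => polyfun_meval (f j) (pphi 0)) (leq_ltn_trans Id dm).
exists D, c; split=> // x /sub[t _ <-].
rewrite -[RHS](cf t) raddf_sum; apply: eq_bigr => a _ /=.
by rewrite mevalZ rmorph_monomial.
Qed.

(** The [m] polynomials separating consecutive sets are independent on [Z m]; were [d < m], a
    relation between them on [S] would carry over to [Z m]. *)
Lemma chain_length_le X d m : has_irreducible_chain X m ->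
  (forall Z, zariski_irreducible Z -> Z `<=` X ->
     exists2 S, trdeg_le d S & forall p, vanish S p -> vanish Z p) ->
  (m <= d)%N.
Proof.
case=> Z [closedZ ltZ] bound; rewrite leqNgt; apply/negP => dm.
have irrZ j : (j <= m)%N -> zariski_irreducible (Z j) by case/closedZ.
have [||S tS sub] := bound (Z m); first exact: irrZ.
  by have [[T ->] _] := closedZ m (leqnn _); apply: subIset; left.
(* The implication sits under the existential, with 0 chosen from [m] on, so that [choice] yields a
   total sequence. *)
have sep j : exists f, (j < m)%N ->
    [/\ Z j `<=` Z j.+1, vanish (Z j) f & ~ vanish (Z j.+1) f].
  case: (ltnP j m) => [jm|]; last by exists 0.
  have [subj /existsNP[x /not_implyP[Zx nZx]]] := ltZ j jm.
  have [[T ZT] _] := closedZ j (ltnW jm).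
  have [[T' ZT'] _] := closedZ j.+1 jm.
  have [p [Tp px]] : exists p, T p /\ p.@[x 0] <> 0.
    apply: contrapT => np; apply: nZx; rewrite ZT; split.
      by move: Zx; rewrite ZT' => -[].
    by move=> p Tp; apply: contrapT => px; apply: np; exists p.
  exists p => _; split; first exact: subj.
    by rewrite ZT => y [_]; apply.
  by move=> /(_ x Zx).
have [f Hf] := choice sep.
have [D [c [[a ca] vc]]] := tS m f dm.
by move/eqP: ca; apply; apply: (chain_independence irrZ Hf); apply: sub.
Qed.

End ZariskiDimension.

(** * Irreducible sets and chains from polynomial parametrizations *)

Section PolynomialImages.
Variables (k : closedFieldType) (N : nat).
Local Open Scope classical_set_scope.

Definition closure_in (X S : set 'rV[k]_N) := X `&` zero_locus (vanish S).

(** If both closed parts are proper, each has an equation that fails at some parameter;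
    [polyfun_identity] gives one parameter where both fail, and its image lies in neither part. *)
Lemma closure_in_irreducible I (X : set 'rV[k]_N) (phi : (I -> k) -> 'rV[k]_N) :
  polymx phi -> range phi `<=` X ->
  zariski_irreducible (closure_in X (range phi)).
Proof.
move=> pphi sub; have sub_cl : range phi `<=` closure_in X (range phi).
  by move=> x Sx; split; [apply: sub | move=> p; apply].
split; first by exists (phi (fun=> 0)); apply: sub_cl; exists (fun=> 0).
move=> A B [SA ->] [SB ->] cover.
have full S : (forall p, S p -> vanish (range phi) p) ->
    closure_in X (range phi) = closure_in X (range phi) `&` zero_locus S.
  move=> vS; apply/seteqP; split=> x; [case=> Xx clx | by case].
  by split=> // p /vS; apply: clx.
have wit S : ~ (forall p, S p -> vanish (range phi) p) ->
    exists p t, S p /\ p.@[phi t 0] != 0.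
  move=> /existsNP[p /not_implyP[Sp /existsNP[x /not_implyP[[t _ <-] /eqP nx]]]].
  by exists p, t.
case: (pselect (forall p, SA p -> vanish (range phi) p)) => [/full|/wit nA].
  by left.
case: (pselect (forall p, SB p -> vanish (range phi) p)) => [/full|/wit nB].
  by right.
case: nA => p [a [Sp pa]]; case: nB => q [b [Sq qb]].
have [t [pt qt]] := polyfun_identity (polyfun_meval p (pphi 0))
  (polyfun_meval q (pphi 0)) pa qb.
have : closure_in X (range phi) (phi t) by apply: sub_cl; exists t.
rewrite cover => -[[_ /(_ p Sp) p0]|[_ /(_ q Sq) q0]].
  by rewrite p0 eqxx in pt.
by rewrite q0 eqxx in qt.
Qed.

(* [Z_n] is the closure of the image of the parameters of rank less than [n],
   the other ones being set to [0]; [q j] separates [Z_(rk j)] from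
   [Z_(rk j + 1)]. *)
Lemma has_chain_of_parametrization (X : set 'rV[k]_N) (I : finType)
    (phi : (I -> k) -> 'rV[k]_N) (rk : I -> nat) (q : I -> {mpoly k[N]}) :
  polymx phi -> range phi `<=` X ->
  (forall i, (i < #|I|)%N -> exists j, rk j = i) ->
  (forall j t, (forall l, (rk j < rk l)%N -> t l = 0) -> (q j).@[phi t 0] = t j) ->
  has_irreducible_chain X #|I|.
Proof.
move=> pphi sub rk_onto read.
pose mask n (t : I -> k) i := if (rk i < n)%N then t i else 0.
pose S n := range (fun t => phi (mask n t)).
have pS n : polymx (fun t => phi (mask n t)).
  move=> i j; apply: (polyfun_comp (s := mask n) (pphi i j)) => l; rewrite /mask.
  by case: (rk l < n)%N; [apply: polyfun_var | apply: polyfun_const].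
have subS n : S n `<=` X by move=> x [t _ <-]; apply: sub; exists (mask n t).
exists (fun n => closure_in X (S n)); split=> n leIn.
  split; last exact: (closure_in_irreducible (pS n) (subS n)).
  by exists (vanish (S n)).
split.
  move=> x [Xx clx]; split=> // p vp; apply: clx; apply: vanishS vp => y [t _ <-].
  exists (mask n t) => //; congr phi; apply/funext => i; rewrite /mask.
  by case: (ltnP (rk i) n) => [/ltnW|_]; [rewrite ltnS => -> | case: ifP].
have [j rkj] := rk_onto n leIn; subst n.
(* The image of this indicator lies in the stage after [rk j]; there [q j] takes the value 1, while
   it vanishes on [S (rk j)]. *)
pose t l : k := (l == j)%:R.
have mt : mask (rk j).+1 t = t.
  apply/funext => l; rewrite /mask /t; case: eqP => [->|_]; first by rewrite ltnS leqnn.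
  by case: ifP.
move=> /(_ (phi t)); case.
  split; first by apply: sub; exists t.
  by move=> p vp; apply: vp; exists t; rewrite ?mt.
move=> _ /(_ (q j)); rewrite read; last first.
  by move=> l; rewrite /t; case: eqP => [->|//]; rewrite ltnn.
have -> : t j = 1 by rewrite /t eqxx.
move=> q1; suff /q1/eqP : vanish (S (rk j)) (q j) by rewrite oner_eq0.
move=> x [u _ <-].
rewrite read /mask ?ltnn // => l ltl; by rewrite ltnNge ltnW.
Qed.

End PolynomialImages.

(** * Cyclic vectors of three by three matrices *)

Section ThreeDimensional.
Variable k : closedFieldType.
Implicit Types (x y z u v w : 'rV[k]_3) (A B : 'M[k]_3).

Local Notation o0 := (@Ordinal 3 0 isT).
Local Notation o1 := (@Ordinal 3 1 isT).
Local Notation o2 := (@Ordinal 3 2 isT).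

Lemma ord3_ind (P : 'I_3 -> Prop) : P o0 -> P o1 -> P o2 -> forall i, P i.
Proof.
move=> P0 P1 P2 [[|[|[|//]]] lti].
- by rewrite (_ : Ordinal lti = o0) //; apply/val_inj.
- by rewrite (_ : Ordinal lti = o1) //; apply/val_inj.
- by rewrite (_ : Ordinal lti = o2) //; apply/val_inj.
Qed.

Lemma sum_ord3 (V : nmodType) (F : 'I_3 -> V) :
  \sum_i F i = F o0 + F o1 + F o2.
Proof.
rewrite !big_ord_recr big_ord0 /= add0r.
by congr (F _ + F _ + F _); apply/val_inj.
Qed.

Lemma row3P x y : x 0 o0 = y 0 o0 -> x 0 o1 = y 0 o1 -> x 0 o2 = y 0 o2 -> x = y.
Proof. by move=> *; apply/rowP; elim/ord3_ind. Qed.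

Definition row3 (a b c : k) : 'rV[k]_3 := \row_j [:: a; b; c]`_j.

Lemma row3E a b c :
  (row3 a b c 0 o0 = a) * (row3 a b c 0 o1 = b) * (row3 a b c 0 o2 = c).
Proof. by rewrite !mxE. Qed.

Definition det3 x y z : k :=
  x 0 o0 * (y 0 o1 * z 0 o2 - y 0 o2 * z 0 o1)
  - x 0 o1 * (y 0 o0 * z 0 o2 - y 0 o2 * z 0 o0)
  + x 0 o2 * (y 0 o0 * z 0 o1 - y 0 o1 * z 0 o0).

Definition dot x y : k := x 0 o0 * y 0 o0 + x 0 o1 * y 0 o1 + x 0 o2 * y 0 o2.

Definition cross x y : 'rV[k]_3 :=
  row3 (x 0 o1 * y 0 o2 - x 0 o2 * y 0 o1)
       (x 0 o2 * y 0 o0 - x 0 o0 * y 0 o2)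
       (x 0 o0 * y 0 o1 - x 0 o1 * y 0 o0).

Lemma det3E A : \det A = det3 (row o0 A) (row o1 A) (row o2 A).
Proof.
(* With entries read through natural numbers, the lifted indices of the cofactors compute to
   numerals before [ring]. *)
pose f (i j : nat) := A (inord i) (inord j).
have Af i j : A i j = f i j by rewrite /f !inord_val.
rewrite (expand_det_row _ ord0) !big_ord_recl big_ord0 /cofactor.
rewrite !(expand_det_row _ ord0) !big_ord_recl !big_ord0 /cofactor !det_mx11.
rewrite /det3 !mxE !Af /= /bump /=; ring.
Qed.

(** Multiplicativity of the determinant in coordinates; later determinants are evaluated by
    expressing their rows in three fixed vectors. *)
Lemma det3_comb x y z a1 b1 c1 a2 b2 c2 a3 b3 c3 :
  det3 (a1 *: x + b1 *: y + c1 *: z) (a2 *: x + b2 *: y + c2 *: z)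
       (a3 *: x + b3 *: y + c3 *: z) =
  (a1 * (b2 * c3 - c2 * b3) - b1 * (a2 * c3 - c2 * a3)
   + c1 * (a2 * b3 - b2 * a3)) * det3 x y z.
Proof. rewrite /det3 !mxE; ring. Qed.

(** Nonzero exactly when the row vector [x] is cyclic for [A]. *)
Definition cyclic_det x A : k := det3 x (x *m A) (x *m A *m A).

(** The shift changes the three rows by a unitriangular matrix. *)
Lemma cyclic_det_shift x A (c : k) : cyclic_det x (A + c%:M) = cyclic_det x A.
Proof.
rewrite /cyclic_det mulmxDr !mulmxDl !mulmxDr !mul_mx_scalar -scalemxAl.
move: (x *m A) => y; move: (y *m A) => z.
transitivity (det3 (1 *: x + 0 *: y + 0 *: z) (c *: x + 1 *: y + 0 *: z)
  (c ^+ 2 *: x + (c + c) *: y + 1 *: z)); last by rewrite det3_comb; ring.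
by congr (det3 _ _ _); apply/rowP => j; rewrite !mxE; ring.
Qed.

(** In the basis of the [x A^i], the vector [x B] equals [x P] for a quadratic polynomial [P] in
    [A]. Both [B] and [P] commute with [A], so they agree on the whole basis. *)
Lemma cyclic_commutant x A B : cyclic_det x A != 0 -> A *m B = B *m A ->
  exists c : 'I_3 -> k, B = \sum_j c j *: A ^+ j.
Proof.
move=> dx cAB; pose K := \matrix_(i < 3) (x *m A ^+ i).
have unitK : K \in unitmx.
  rewrite unitmxE unitfE det3E !rowK /= expr0 expr1 expr2 mulmx1.
  by rewrite -[A * A]/(A *m A) mulmxA.
have cX C i : A *m C = C *m A -> A ^+ i *m C = C *m A ^+ i.
  by move=> cC; elim: i => [|i IH]; rewrite ?expr0 ?mulmx1 ?mul1mx // exprS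
    -[A * _]/(A *m _) -mulmxA IH mulmxA cC mulmxA.
pose c := x *m B *m invmx K; pose P := \sum_(j < 3) c 0 j *: A ^+ j.
exists (c 0); rewrite -/P.
have cP : A *m P = P *m A.
  rewrite mulmx_sumr mulmx_suml; apply: eq_bigr => j _.
  by rewrite -scalemxAr -scalemxAl -[A *m _]/(A * _) -exprS exprSr.
have xP : x *m B = x *m P.
  rewrite -[LHS](mulmxKV unitK) -/c mulmx_sum_row mulmx_sumr.
  by apply: eq_bigr => j _; rewrite rowK scalemxAr.
apply: (can_inj (mulKmx unitK)); apply/row_matrixP => i.
by rewrite !row_mul rowK -!mulmxA !cX // !mulmxA xP.
Qed.

Lemma quadratic_eq0 (a b c : k) :
  (forall s, a * s ^+ 2 + b * s + c = 0) -> [/\ a = 0, b = 0 & c = 0].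
Proof.
move=> H; pose p : {poly k} := a *: 'X^2 + b *: 'X + c%:P.
have p0 : p = 0.
  apply/eqP; apply: contraT => /closed_nonrootP[s] /negP[].
  by rewrite rootE !hornerD !hornerZ hornerXn hornerX hornerC H.
have co i : p`_i = 0 by rewrite p0 coef0.
have := co 0; have := co 1; have := co 2.
by rewrite !coefE /= !mulr1 !mulr0 !addr0 !add0r.
Qed.

(** The hypothesis makes every vector an eigenvector. Basis vectors kill the off-diagonal entries;
    [e_0 + e_1] and [e_0 + e_2] equate the diagonal ones. *)
Lemma noncyclic_scalar A :
  (forall x y, det3 x (x *m A) y = 0) -> A = (A o0 o0)%:M.
Proof.
move=> H; pose e a b c := row3 a b c.
have D a b c a' b' c' := H (row3 a b c) (row3 a' b' c').
have H01 := D 1 0 0 0 0 1; have H02 := D 1 0 0 0 1 0.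
have H10 := D 0 1 0 0 0 1; have H12 := D 0 1 0 1 0 0.
have H20 := D 0 0 1 0 1 0; have H21 := D 0 0 1 1 0 0.
have H11 := D 1 1 0 0 0 1; have H22 := D 1 0 1 0 1 0.
move: H01 H02 H10 H12 H20 H21 H11 H22 {D H}.
rewrite /det3 !row3E !mxE !sum_ord3 !row3E => H01 H02 H10 H12 H20 H21 H11 H22.
have A01 : A o0 o1 = 0 by rewrite -[RHS]H01; ring.
have A02 : A o0 o2 = 0 by rewrite -[RHS]oppr0 -[in RHS]H02; ring.
have A10 : A o1 o0 = 0 by rewrite -[RHS]oppr0 -[in RHS]H10; ring.
have A12 : A o1 o2 = 0 by rewrite -[RHS]H12; ring.
have A20 : A o2 o0 = 0 by rewrite -[RHS]H20; ring.
have A21 : A o2 o1 = 0 by rewrite -[RHS]oppr0 -[in RHS]H21; ring.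
have A11 : A o1 o1 = A o0 o0.
  by apply/eqP; rewrite -subr_eq0; apply/eqP; rewrite -[RHS]H11 A01 A10; ring.
have A22 : A o2 o2 = A o0 o0.
  apply/eqP; rewrite -subr_eq0; apply/eqP.
  by rewrite -[RHS]oppr0 -[in RHS]H22 A02 A20; ring.
by apply/matrixP; elim/ord3_ind; elim/ord3_ind; rewrite !mxE.
Qed.

(** Unless every vector is an eigenvector, some [x], [w = x A] and [y] form a basis. Noncyclicity of
    [x] and of all [y + s x] shows that [A - m] maps this basis to multiples of [w - m x], where [m]
    is the [y] coordinate of [y A]. *)
Lemma noncyclic_rank_one A : (forall x, cyclic_det x A = 0) ->
  exists m u w, A = m%:M + u^T *m w.
Proof.
move=> H; case: (pselect (forall x y, det3 x (x *m A) y = 0)) => [Hs|].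
  by exists (A o0 o0), 0, 0; rewrite mulmx0 addr0; apply: noncyclic_scalar.
move=> /existsNP[x /existsNP[y /eqP dP]]; set w := x *m A in dP.
pose P := \matrix_(i < 3) nth 0 [:: x; w; y] i.
have unitP : P \in unitmx by rewrite unitmxE unitfE det3E !rowK.
have coord v : exists a b c, v = a *: x + b *: w + c *: y.
  exists ((v *m invmx P) 0 o0), ((v *m invmx P) 0 o1), ((v *m invmx P) 0 o2).
  by rewrite -[LHS](mulmxKV unitP) mulmx_sum_row sum_ord3 !rowK.
have [al [be [g wA]]] := coord (w *m A).
have [p [q [m yA]]] := coord (y *m A).
have g0 : g = 0.
  have := H x; rewrite /cyclic_det -/w wA => dg.
  apply: (mulIf dP); rewrite mul0r -[RHS]dg.
  transitivity (det3 (1 *: x + 0 *: w + 0 *: y) (0 *: x + 1 *: w + 0 *: y)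
    (al *: x + be *: w + g *: y)); first by rewrite det3_comb; ring.
  by congr (det3 _ _ _); rewrite !scale0r !scale1r !addr0 ?add0r.
rewrite g0 scale0r addr0 in wA.
(* The left side is the cyclic determinant of [y + s x], computed in the basis [x], [w], [y]. *)
have quad s : (m ^+ 2 - m * be - al) * s ^+ 2
    + (p * be - m * p *+ 2 - m * q * be - q * al *+ 2) * s
    + (p ^+ 2 + p * q * be - q ^+ 2 * al) = 0.
  have := H (y + s *: x); rewrite /cyclic_det !mulmxDl -!scalemxAl -/w yA.
  rewrite !mulmxDl -!scalemxAl -/w wA yA => dz.
  apply: (mulIf dP); rewrite mul0r -[RHS]dz.
  transitivity (det3 (s *: x + 0 *: w + 1 *: y) (p *: x + (q + s) *: w + m *: y)
    (((q + s) * al + m * p) *: x + (p + (q + s) * be + m * q) *: w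
     + m ^+ 2 *: y)); first by rewrite det3_comb; ring.
  by congr (det3 _ _ _); apply/rowP => j; rewrite !mxE; ring.
have [al_eq lin_eq const_eq] := quadratic_eq0 quad.
have {}al_eq : al = m ^+ 2 - m * be.
  by apply/eqP; rewrite eq_sym -subr_eq0; apply/eqP.
(* The linear coefficient factors as [(p + q m) (be - 2 m)]; if the second factor is zero, the
   constant one becomes [(p + q m)^2]. *)
have p_eq : p = - (q * m).
  apply/eqP; rewrite -subr_eq0 opprK; apply/eqP.
  rewrite al_eq in lin_eq const_eq.
  have /eqP : (p + q * m) * (be - m *+ 2) = 0 by rewrite -[RHS]lin_eq; ring.
  rewrite mulf_eq0 => /orP[/eqP //|]; rewrite subr_eq0 => /eqP be_eq.
  have /eqP : (p + q * m) ^+ 2 = 0 by rewrite -[RHS]const_eq be_eq; ring.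
  by rewrite expf_eq0 => /eqP.
(* [A - m] sends [x], [w], [y] to 1, [be - m] and [q] times [w - m x]; the inverse of [P] returns
   this column to standard coordinates. *)
exists m, (row3 1 (be - m) q *m (invmx P)^T), (w - m *: x).
set w' := w - m *: x; rewrite trmx_mul trmxK -mulmxA; apply: (can_inj (mulKmx unitP)).
rewrite mulmxDr mulKVmx // mul_mx_scalar; apply/row_matrixP => i.
rewrite row_mul linearD linearZ /= !rowK row_mul.
rewrite [row i _](_ : _ = (row3 1 (be - m) q 0 i)%:M); last first.
  by apply/matrixP => a b; rewrite !ord1 !mxE mulr1n.
rewrite mul_scalar_mx; move: i; apply: ord3_ind; rewrite row3E /= /w'.
- by rewrite -/w scale1r addrC subrK.
- by rewrite wA al_eq; apply/rowP => j; rewrite !mxE; ring.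
- by rewrite yA p_eq; apply/rowP => j; rewrite !mxE; ring.
Qed.

(** * Commuting matrices of rank at most one *)

Lemma mulmx_rank_one x u w : x *m (u^T *m w) = dot x u *: w.
Proof.
rewrite mulmxA [x *m _](_ : _ = (dot x u)%:M) ?mul_scalar_mx //.
by apply/matrixP => i j; rewrite !ord1 !mxE sum_ord3 !mxE mulr1n.
Qed.

Lemma rank_oneE u w i j : (u^T *m w) i j = u 0 i * w 0 j.
Proof. by rewrite mxE big_ord1 mxE. Qed.

Lemma rank_one_mul u w u' w' :
  (u^T *m w) *m (u'^T *m w') = dot w u' *: (u^T *m w').
Proof. by rewrite -mulmxA mulmx_rank_one scalemxAr. Qed.

Lemma dotC x y : dot x y = dot y x.
Proof. by rewrite /dot; ring. Qed.

Lemma dotZl c x y : dot (c *: x) y = c * dot x y.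
Proof. by rewrite /dot !mxE; ring. Qed.

Lemma dotDl x y z : dot (x + y) z = dot x z + dot y z.
Proof. by rewrite /dot !mxE; ring. Qed.

Lemma dotZr c x y : dot x (c *: y) = c * dot x y.
Proof. by rewrite dotC dotZl dotC. Qed.

Lemma crossZr c x y : cross x (c *: y) = c *: cross x y.
Proof. by apply: row3P; rewrite [RHS]mxE !row3E !mxE; ring. Qed.

Lemma crossC x y : cross x y = - cross y x.
Proof. by apply: row3P; rewrite [RHS]mxE !row3E; ring. Qed.

Lemma crossvv x : cross x x = 0.
Proof. by apply: row3P; rewrite [RHS]mxE !row3E; ring. Qed.

Lemma cross0v x : cross 0 x = 0.
Proof. by apply: row3P; rewrite [RHS]mxE !row3E !mxE; ring. Qed.

Lemma crossv0 x : cross x 0 = 0.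
Proof. by rewrite crossC cross0v oppr0. Qed.

Lemma cross_eq0P x y :
  cross x y = 0 <-> forall i j, x 0 i * y 0 j = x 0 j * y 0 i.
Proof.
split=> [xy0|H].
  have E l : cross x y 0 l = 0 by rewrite xy0 mxE.
  have /eqP := E o0; have /eqP := E o1; have /eqP := E o2.
  rewrite !row3E !subr_eq0 => /eqP E2 /eqP E1 /eqP E0.
  by elim/ord3_ind; elim/ord3_ind.
by apply: row3P; rewrite [RHS]mxE row3E (H _ _) subrr.
Qed.

Lemma parallel_scale u v : u != 0 -> cross u v = 0 -> exists c, v = c *: u.
Proof.
case/rV0Pn => i ui /cross_eq0P uv; exists (v 0 i / u 0 i).
apply/rowP => j; rewrite mxE; apply: (mulIf ui).
by rewrite [LHS]mulrC uv mulrAC divfK // mulrC.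
Qed.

Lemma cross_cross x y z : cross (cross x y) z = dot x z *: y - dot y z *: x.
Proof. by apply: row3P; rewrite [RHS]mxE !row3E /dot !mxE; ring. Qed.

Lemma det3_dot x y z : det3 x y z = dot x (cross y z).
Proof. by rewrite /det3 /dot !row3E; ring. Qed.

Lemma orthogonal_to_pair p q v : cross p q != 0 ->
  dot p v = 0 -> dot q v = 0 -> exists c, v = c *: cross p q.
Proof.
move=> pq pv qv; apply: parallel_scale => //.
by rewrite cross_cross pv qv !scale0r subr0.
Qed.

Lemma orthogonal_to_cross p q v : cross p q != 0 -> dot v (cross p q) = 0 ->
  exists a b, v = a *: p + b *: q.
Proof.
case/rV0Pn => j gj vg.
(* Cramer's rule, with a nonzero coordinate of [cross p q] as denominator. *)
have id l : cross p q 0 j * v 0 l = cross v q 0 j * p 0 l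
    + cross p v 0 j * q 0 l + (j == l)%:R * dot v (cross p q).
  move: j l {gj vg}; apply: ord3_ind; apply: ord3_ind;
    by rewrite /dot !row3E /=; ring.
exists (cross v q 0 j / cross p q 0 j), (cross p v 0 j / cross p q 0 j).
apply/rowP => l; apply: (mulfI gj).
have combE (a b : k) : (a *: p + b *: q) 0 l = a * p 0 l + b * q 0 l.
  by rewrite !mxE.
rewrite combE.
rewrite id vg mulr0 addr0; move: (cross p q 0 j) gj => g g0.
by field.
Qed.

(** Commutation equates [dot w u'] times [u^T w'] with [dot w' u] times [u'^T w]. Were [dot w u']
    nonzero, the column of a nonzero entry of [w'] would make [u] a multiple of [u']. *)
Lemma rank_one_comm_dot u w u' w' :
  (u^T *m w) *m (u'^T *m w') = (u'^T *m w') *m (u^T *m w) ->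
  cross u u' != 0 -> w' != 0 -> dot w u' = 0.
Proof.
rewrite !rank_one_mul => comm /eqP cu /rV0Pn[b wb].
have E a : dot w u' * (u 0 a * w' 0 b) = dot w' u * (u' 0 a * w 0 b).
  have := congr1 (fun M : 'M_3 => M a b) comm.
  by rewrite mxE rank_oneE [RHS]mxE rank_oneE.
apply: contrapT => /eqP wu; apply: cu; apply/cross_eq0P => i j.
have dwb : dot w u' * w' 0 b != 0 by rewrite mulf_neq0.
apply: (mulfI dwb).
transitivity (dot w u' * (u 0 i * w' 0 b) * u' 0 j); first by ring.
transitivity (dot w u' * (u 0 j * w' 0 b) * u' 0 i); last by ring.
by rewrite !E; ring.
Qed.

Lemma rank_one_comm_tr u w u' w' :
  (u^T *m w) *m (u'^T *m w') = (u'^T *m w') *m (u^T *m w) ->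
  (w^T *m u) *m (w'^T *m u') = (w'^T *m u') *m (w^T *m u).
Proof.
by move/(congr1 trmx); rewrite !trmx_mul !trmxK !mulmxA.
Qed.

Lemma avoid_three_planes u v w : u != 0 -> v != 0 -> w != 0 ->
  exists x, [/\ dot x u != 0, dot x v != 0 & dot x w != 0].
Proof.
pose pt (t : 'I_3 -> k) : 'rV_3 := \row_i t i.
have poly y : polyfun (fun t => dot (pt t) y).
  rewrite (_ : (fun _ => _) =
    fun t => t o0 * y 0 o0 + t o1 * y 0 o1 + t o2 * y 0 o2); last first.
    by apply/funext => t; rewrite /dot !mxE.
  by do 2?[apply: polyfun_add]; apply: polyfun_mul;
    by [apply: polyfun_var | apply: polyfun_const].
have wit y : y != 0 -> exists t, dot (pt t) y != 0.
  case/rV0Pn => i yi; exists (fun j => (j == i)%:R); rewrite /dot !mxE.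
  by move: i yi; apply: ord3_ind => /= yi;
    rewrite ?mul1r ?mul0r ?addr0 ?add0r.
move=> /wit[a ua] /wit[b vb] /wit[c wc].
have [t [ut vt]] := polyfun_identity (poly u) (poly v) ua vb.
have uvt : dot (pt t) u * dot (pt t) v != 0 by rewrite mulf_neq0.
have [s []] := polyfun_identity (polyfun_mul (poly u) (poly v)) (poly w) uvt wc.
by rewrite mulf_eq0 negb_or => /andP[us vs] ws; exists (pt s).
Qed.

(** If neither pair is parallel, commutation gives [dot w u' = dot w' u = 0]. For [x] off three
    planes, the cyclic determinant is a nonzero multiple of [s (s dot w' u' - dot w u)], so these
    products vanish too. Then [u] and [u'] are both multiples of [cross w w'], a contradiction. *)
Lemma noncyclic_pair u w u' w' :
  (u^T *m w) *m (u'^T *m w') = (u'^T *m w') *m (u^T *m w) ->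
  (forall s x, cyclic_det x (u^T *m w + s *: (u'^T *m w')) = 0) ->
  cross u u' = 0 \/ cross w w' = 0.
Proof.
move=> comm nc; have [cu|cu] := eqVneq (cross u u') 0; first by left.
have [cw|cw] := eqVneq (cross w w') 0; [by right | exfalso].
have neq0 x y : cross x y != 0 -> x != 0 /\ y != 0.
  by move=> xy; split; apply: contraNneq xy => ->; rewrite ?cross0v ?crossv0.
have [u0 u'0] := neq0 _ _ cu; have [w0 w'0] := neq0 _ _ cw.
have wu' := rank_one_comm_dot comm cu w'0.
have w'u : dot w' u = 0.
  apply: (rank_one_comm_dot (esym comm)) => //.
  by rewrite crossC oppr_eq0.
have [x [xu xu' xw]] := avoid_three_planes u0 u'0 cw.
have key s : s * (s * dot w' u' - dot w u) = 0.
  have := nc s x; rewrite /cyclic_det !mulmxDr -!scalemxAr !mulmx_rank_one.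
  rewrite !dotDl !dotZl wu' w'u => dx.
  have d0 : dot x u * dot x u' * det3 x w w' != 0.
    by rewrite !mulf_neq0 // det3_dot.
  apply: (mulIf d0); rewrite mul0r -[RHS]dx.
  transitivity (det3 (1 *: x + 0 *: w + 0 *: w')
    (0 *: x + dot x u *: w + (s * dot x u') *: w')
    (0 *: x + (dot x u * dot w u) *: w
      + (s ^+ 2 * dot x u' * dot w' u') *: w')); first by rewrite det3_comb; ring.
  by congr (det3 _ _ _); apply/rowP => j; rewrite !mxE; ring.
have [w'u' wu _] : [/\ dot w' u' = 0, - dot w u = 0 & 0 = 0 :> k].
  by apply: quadratic_eq0 => s; rewrite -[RHS](key s); ring.
have {}wu : dot w u = 0 by apply/eqP; rewrite -oppr_eq0 wu.
have [c uc] := orthogonal_to_pair cw wu w'u.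
have [c' uc'] := orthogonal_to_pair cw wu' w'u'.
move/eqP: cu; apply; rewrite uc uc' crossZr crossC crossZr.
by rewrite crossvv scaler0 oppr0 scaler0.
Qed.

(** Put [p = w i1], [q = w i2]. Then [u i1] and [u i2] are parallel, and commutation makes them
    orthogonal to [p] and [q], hence multiples of [cross p q]. In any other nonzero term [u i] is
    parallel to them, since otherwise [w i] would be parallel to both [p] and [q]; and [w i],
    orthogonal to [cross p q], lies in the span of [p] and [q]. *)
Lemma common_left_factor (J : Type) (u w : J -> 'rV[k]_3) i1 i2 :
  (forall i j, ((u i)^T *m w i) *m ((u j)^T *m w j) =
               ((u j)^T *m w j) *m ((u i)^T *m w i)) ->
  (forall i j, cross (u i) (u j) = 0 \/ cross (w i) (w j) = 0) ->
  u i1 != 0 -> u i2 != 0 -> cross (w i1) (w i2) != 0 ->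
  exists p q (a b : J -> k), forall i,
    (u i)^T *m w i = (cross p q)^T *m (a i *: p + b i *: q).
Proof.
move=> comm par u1 u2 w12; set p := w i1; set q := w i2.
have dot0 i j : cross (w i) (w j) != 0 -> u j != 0 -> dot (w j) (u i) = 0.
  move=> wij uj; rewrite dotC.
  exact: rank_one_comm_dot (rank_one_comm_tr (comm i j)) wij uj.
have u12 : cross (u i1) (u i2) = 0 by case: (par i1 i2) => // /eqP; rewrite (negPf w12).
have [c2 u2E] := parallel_scale u1 u12.
have c20 : c2 != 0 by apply: contraNneq u2 => c20; rewrite u2E c20 scale0r.
have qu : dot q (u i1) = 0 by apply: dot0.
have pu : dot p (u i1) = 0.
  have := dot0 i2 i1; rewrite crossC oppr_eq0 => /(_ w12 u1).
  by rewrite u2E dotZr => /eqP; rewrite mulf_eq0 (negPf c20) => /eqP.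
have [d u1E] := orthogonal_to_pair w12 pu qu.
suff /choice[ab Hab] : forall i, exists ab : k * k,
    (u i)^T *m w i = (cross p q)^T *m (ab.1 *: p + ab.2 *: q).
  by exists p, q, (fun i => (ab i).1), (fun i => (ab i).2).
move=> i; suff [z zg ->] : exists2 z, dot z (cross p q) = 0 &
    (u i)^T *m w i = (cross p q)^T *m z.
  by have [a [b ->]] := orthogonal_to_cross w12 zg; exists (a, b).
have [ui|ui] := eqVneq (u i) 0.
  by exists 0; rewrite ?ui ?trmx0 ?mul0mx ?mulmx0 // /dot !mxE !mul0r !addr0.
have [wi|wi] := eqVneq (w i) 0.
  by exists 0; rewrite ?wi ?mulmx0 // /dot !mxE !mul0r !addr0.
have [/(parallel_scale u1)[c uE]|nu] := eqVneq (cross (u i1) (u i)) 0.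
  exists ((c * d) *: w i); last by rewrite uE u1E !linearZ /= -!scalemxAl scalerA.
  suff wu : dot (w i) (u i1) = 0 by rewrite dotZl -mulrA -dotZr -u1E wu mulr0.
  have [pw|pw] := eqVneq (cross p (w i)) 0; last exact: dot0.
  have p0 : p != 0 by apply: contraNneq w12 => p0; rewrite -/p p0 cross0v.
  by have [c' ->] := parallel_scale p0 pw; rewrite dotZl pu mulr0.
have pw : cross p (w i) = 0 by case: (par i1 i) => // /eqP; rewrite (negPf nu).
have qw : cross q (w i) = 0.
  case: (par i2 i) => //; rewrite u2E crossC crossZr crossC => /eqP.
  by rewrite oppr_eq0 scaler_eq0 oppr_eq0 (negPf c20) (negPf nu).
have p0 : p != 0 by apply: contraNneq w12 => p0; rewrite -/p p0 cross0v.
have [c wE] := parallel_scale p0 pw; move/eqP: qw.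
rewrite wE crossZr crossC scaler_eq0 oppr_eq0 (negPf w12) orbF => /eqP c0.
by rewrite wE c0 scale0r eqxx in wi.
Qed.

(** * The four types of commuting tuples *)

Theorem commuting_classification (J : finType) (V : J -> 'M[k]_3) :
  (forall i j, V i *m V j = V j *m V i) ->
  [\/ exists (a : J -> k) x, cyclic_det x (\sum_i a i *: V i) != 0,
      exists u w (a c : J -> k), forall i, V i = (a i)%:M + c i *: (u^T *m w),
      exists p q (a b c : J -> k), forall i,
        V i = (a i)%:M + (cross p q)^T *m (b i *: p + c i *: q) |
      exists p q (a b c : J -> k), forall i,
        V i = (a i)%:M + (b i *: p + c i *: q)^T *m cross p q].
Proof.
move=> comm.
case: (pselect (exists (a : J -> k) x, cyclic_det x (\sum_i a i *: V i) != 0)).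
  by move=> ?; apply: Or41.
move=> nocyc; have noncyc a x : cyclic_det x (\sum_i a i *: V i) = 0.
  by apply: contrapT => /eqP dx; apply: nocyc; exists a, x.
have sum1 i c : \sum_j (if j == i then c else 0) *: V j = c *: V i.
  by rewrite (bigD1 i) //= eqxx big1 ?addr0 // => j /negPf ->; rewrite scale0r.
have rank1 i : exists muw : k * ('rV[k]_3 * 'rV[k]_3),
    V i = muw.1%:M + muw.2.1^T *m muw.2.2.
  have [|m [u [w Vi]]] := @noncyclic_rank_one (V i); last by exists (m, (u, w)).
  by move=> x; rewrite -[V i]scale1r -sum1 noncyc.
have [muw] := choice rank1.
pose a i := (muw i).1; pose u i := (muw i).2.1; pose w i := (muw i).2.2.
pose n i := (u i)^T *m w i => VE.
have {}VE i : V i = (a i)%:M + n i by exact: VE.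
have nE i : n i = V i - (a i)%:M by rewrite VE addrC addKr.
have commn i j : n i *m n j = n j *m n i.
  rewrite !nE; apply: comm_mxB; last exact: comm_mx_scalar.
  apply: comm_mx_sym; apply: comm_mxB; first exact: comm.
  exact: comm_mx_scalar.
have par i j : cross (u i) (u j) = 0 \/ cross (w i) (w j) = 0.
  apply: noncyclic_pair (commn i j) _ => s x.
  (* A scalar shift turns [n i + s n j] into [V i + s V j]; adding two indicators as coefficients
     also covers [i = j]. *)
  rewrite -(cyclic_det_shift x _ (a i + s * a j)).
  rewrite -[RHS](noncyc (fun l => (if l == i then 1 else 0)
    + (if l == j then s else 0)) x); congr cyclic_det.
  under [in RHS]eq_bigr do rewrite scalerDl.
  rewrite big_split /= !sum1 scale1r -/(n i) -/(n j) !nE.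
  have -> : (a i + s * a j)%:M = (a i)%:M + s *: (a j)%:M :> 'M_3.
    by rewrite raddfD /= scale_scalar_mx.
  by rewrite addrACA subrK -scalerDr subrK.
(* A fixed nonzero [n i1] is the reference: a row factor not parallel to its own gives the third
   type, such a column factor the fourth; otherwise all parts are multiples of [n i1]. *)
case: (pselect (exists i, n i != 0)) => [[i1 n1]|n0]; last first.
  apply: Or42; exists 0, 0, a, (fun=> 0) => i; rewrite VE scale0r.
  by congr (_ + _); apply: contrapT => /eqP ni; apply: n0; exists i.
have nz i : n i != 0 -> u i != 0 /\ w i != 0.
  by move=> ni; split; apply: contraNneq ni => e; rewrite /n e ?trmx0 ?mul0mx ?mulmx0.
have [u1 w1] := nz _ n1.
case: (pselect (exists2 i, n i != 0 & cross (w i1) (w i) != 0)) => [[i2 n2 w12]|parw].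
  have [u2 _] := nz _ n2.
  have [p [q [b [c H]]]] := common_left_factor commn par u1 u2 w12.
  by apply: Or43; exists p, q, a, b, c => i; rewrite VE -H.
case: (pselect (exists2 i, n i != 0 & cross (u i1) (u i) != 0)) => [[i2 n2 u12]|paru].
  have [_ w2] := nz _ n2.
  have [|p [q [b [c H]]]] := common_left_factor
    (fun i j => rank_one_comm_tr (commn i j)) _ w1 w2 u12.
    by move=> i j; apply/or_comm.
  apply: Or44; exists p, q, a, b, c => i; rewrite VE; congr (_ + _).
  by apply: trmx_inj; rewrite !trmx_mul !trmxK H.
apply: Or42.
suff /choice[c Hc] : forall i, exists c, n i = c *: n i1.
  by exists (u i1), (w i1), a, c => i; rewrite VE Hc.
move=> i; have [ni|ni] := eqVneq (n i) 0; first by exists 0; rewrite ni scale0r.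
have wi : cross (w i1) (w i) = 0.
  by apply: contrapT => /eqP wi; apply: parw; exists i.
have ui : cross (u i1) (u i) = 0.
  by apply: contrapT => /eqP ui; apply: paru; exists i.
have [c uE] := parallel_scale u1 ui; have [d wE] := parallel_scale w1 wi.
exists (c * d); rewrite /n uE wE -scalemxAr [(c *: _)^T]linearZ /=.
by rewrite -scalemxAl scalerA mulrC.
Qed.

Lemma polyfun_cyclic_det I x (A : (I -> k) -> 'M[k]_3) :
  polymx A -> polyfun (fun t => cyclic_det x (A t)).
Proof.
move=> pA; have px : polymx (fun _ : I -> k => x) by apply: polymx_const.
have pxA := polymx_mul px pA; have pxAA := polymx_mul pxA pA.
by rewrite /cyclic_det /det3; apply: polyfun_add; [apply: polyfun_sub|];
  (apply: polyfun_mul; first exact: px);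
  apply: polyfun_sub; apply: polyfun_mul;
  first [exact: pxA | exact: pxAA].
Qed.

Lemma polymx_cross I (x y : (I -> k) -> 'rV[k]_3) :
  polymx x -> polymx y -> polymx (fun t => cross (x t) (y t)).
Proof.
move=> px py i; rewrite (ord1 i).
pose minor a b t := x t 0 a * y t 0 b - x t 0 b * y t 0 a.
have pminor a b : polyfun (minor a b).
  by apply: polyfun_sub; apply: polyfun_mul; first [exact: px | exact: py].
apply: ord3_ind.
- rewrite (_ : (fun _ => _) = minor o1 o2) //.
  by apply/funext => t; rewrite row3E.
- rewrite (_ : (fun _ => _) = minor o2 o0) //.
  by apply/funext => t; rewrite row3E.
- rewrite (_ : (fun _ => _) = minor o0 o1) //.
  by apply/funext => t; rewrite row3E.
Qed.

End ThreeDimensional.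

(** * Parametrized families covering the commuting variety *)

Section CommutingTuples.
Variable k : closedFieldType.
Local Open Scope classical_set_scope.

Local Notation o0 := (@Ordinal 3 0 isT).
Local Notation o1 := (@Ordinal 3 1 isT).
Local Notation o2 := (@Ordinal 3 2 isT).

Definition tuple_point r (V : 'I_r -> 'M[k]_3) : 'rV[k]_(r * (3 * 3)) :=
  mxvec (\matrix_(i < r) mxvec (V i)).

Lemma tuple_pointK r (V : 'I_r -> 'M[k]_3) i : tuple_mx (tuple_point V) i = V i.
Proof. by rewrite /tuple_mx mxvecK rowK mxvecK. Qed.

Lemma tuple_mxK r (x : 'rV[k]_(r * (3 * 3))) : tuple_point (tuple_mx x) = x.
Proof.
rewrite -[RHS]vec_mxK; congr mxvec.
by apply/row_matrixP => i; rewrite rowK vec_mxK.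
Qed.

Lemma tuple_pointE r (V : 'I_r -> 'M[k]_3) i a b :
  tuple_point V 0 (mxvec_index i (mxvec_index a b)) = V i a b.
Proof. by rewrite mxvecE mxE mxvecE. Qed.

Lemma polymx_tuple_point I r (V : (I -> k) -> 'I_r -> 'M[k]_3) :
  (forall i, polymx (fun t => V t i)) -> polymx (fun t => tuple_point (V t)).
Proof.
move=> pV i j; rewrite (ord1 i); case/mxvec_indexP: j => i' j.
case/mxvec_indexP: j => a b.
rewrite (_ : (fun _ => _) = (fun t => V t i' a b)); first exact: pV.
by apply/funext => t; rewrite tuple_pointE.
Qed.

Lemma polymx_row I m (f : (I -> k) -> 'I_m -> k) :
  (forall j, polyfun (fun t => f t j)) -> polymx (fun t => \row_j f t j).
Proof.
move=> pf i j; rewrite (_ : (fun _ => _) = (fun t => f t j)) //.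
by apply/funext => t; rewrite mxE.
Qed.

Lemma commuting_varietyP r (x : 'rV[k]_(r * (3 * 3))) :
  commuting_variety k r 3 x <->
  forall i j, tuple_mx x i *m tuple_mx x j = tuple_mx x j *m tuple_mx x i.
Proof.
split=> H i j; first by apply/eqP; rewrite -subr_eq0; apply/eqP; apply: H.
by rewrite /lie_bracket H subrr.
Qed.

Definition nilpotent_shift : 'M[k]_3 := \matrix_(i, j) (j == i.+1 :> nat)%:R.

(** For tuples of length [r.+1]: three coefficients for each matrix after the first, and the nine
    entries of the first. *)
Definition regular_param r : finType := ('I_r * 'I_3 + 'I_3 * 'I_3)%type.

(* The base point is the regular nilpotent matrix, where [1, v, v ^+ 2] have
   first rows [e_0, e_1, e_2]: this makes the parameters of the chain readable
   as matrix entries. *)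
Definition regular_mx r (t : regular_param r -> k) : 'M[k]_3 :=
  nilpotent_shift + \matrix_(a, b) t (inr (a, b)).

Definition regular_tuple r (t : regular_param r -> k) (i : 'I_r.+1) : 'M[k]_3 :=
  if unlift ord0 i is Some l
  then \sum_(j < 3) t (inl (l, j)) *: regular_mx t ^+ j else regular_mx t.

Definition regular_point r t := tuple_point (@regular_tuple r t).

Lemma polymx_regular_point r : polymx (@regular_point r).
Proof.
have pm : polymx (@regular_mx r).
  apply: polymx_add; first exact: polymx_const.
  move=> a b; rewrite (_ : (fun _ => _) = (fun t => t (inr (a, b)))).
    exact: polyfun_var.
  by apply/funext => t; rewrite mxE.
apply: polymx_tuple_point => i; rewrite /regular_tuple.
case: (unlift _ _) => [l|//]; apply: polymx_sum => j.
by apply: polymx_scale; [apply: polyfun_var | apply: polymx_exp].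
Qed.

Lemma regular_point_commuting r :
  range (@regular_point r) `<=` commuting_variety k r.+1 3.
Proof.
move=> _ [t _ <-]; apply/commuting_varietyP => i j; rewrite !tuple_pointK.
have comm i' : exists c : 'I_3 -> k,
    regular_tuple t i' = \sum_j c j *: regular_mx t ^+ j.
  rewrite /regular_tuple; case: (unlift _ _) => [l|].
    by exists (fun j => t (inl (l, j))).
  exists (fun j => (j == o1)%:R); rewrite sum_ord3 /= !scale0r scale1r expr1.
  by rewrite add0r addr0.
have [c ->] := comm i; have [d ->] := comm j.
apply: (@comm_mx_sum _ 3) => b _; apply: comm_mx_sym.
apply: (@comm_mx_sum _ 3) => a _; rewrite /comm_mx -!scalemxAl -!scalemxAr.
by rewrite -![_ ^+ _ *m _]/(_ ^+ _ * _ ^+ _) -!exprD addnC scalerA mulrC -scalerA.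
Qed.

(** The coefficients are released before the entries of the first matrix. While that matrix is the
    nilpotent shift, the first row of a quadratic polynomial in it lists the coefficients; its own
    entries are coordinates up to constants. *)
Lemma regular_chain r :
  has_irreducible_chain (commuting_variety k r.+1 3) #|regular_param r|.
Proof.
pose rk (p : regular_param r) : nat := match p with
  | inl (l, j) => (l * 3 + j)%N | inr (a, b) => (r * 3 + (a * 3 + b))%N end.
pose coord i a b : {mpoly k[r.+1 * (3 * 3)]} :=
  'X_(mxvec_index i (mxvec_index a b)).
pose q (p : regular_param r) := match p with
  | inl (l, j) => coord (lift ord0 l) o0 j
  | inr (a, b) => coord ord0 a b - (nilpotent_shift a b)%:MP end.
apply: (has_chain_of_parametrization (rk := rk) (q := q)
  (@polymx_regular_point r) (@regular_point_commuting r)).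
  have decomp m n : (n < m * 3)%N -> exists (a : 'I_m) (b : 'I_3), n = (a * 3 + b)%N.
    rewrite -ltn_divLR // => nm; exists (Ordinal nm).
    by exists (Ordinal (ltn_pmod n (isT : 0 < 3)%N)); rewrite /= -divn_eq.
  move=> n; rewrite card_sum !card_prod !card_ord => nI.
  have [/decomp[l [j ->]]|rn] := ltnP n (r * 3); first by exists (inl (l, j)).
  have [|a [b nE]] := decomp 3 (n - r * 3)%N; first by rewrite ltn_subLR.
  by exists (inr (a, b)); rewrite /= -nE subnKC.
move=> [[l j]|[a b]] t later; last first.
  rewrite mevalB mevalC mevalXU tuple_pointE /regular_tuple unlift_none.
  by rewrite [regular_mx _ _ _]mxE [X in _ + X - _]mxE addrC addKr.
rewrite mevalXU tuple_pointE /regular_tuple liftK.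
have -> : regular_mx t = nilpotent_shift.
  apply/matrixP => a b; rewrite !mxE later ?addr0 //=.
  by have := ltn_ord l; have := ltn_ord j; lia.
rewrite sum_ord3 expr0 expr1 expr2 -[1]/(1%:M) -[nilpotent_shift * _]/(_ *m _).
move: j {later}; apply: ord3_ind; rewrite !mxE !sum_ord3 !mxE /=; ring.
Qed.

(* If the span of the tuple contains a matrix [w] with a cyclic vector, then
   [(1 - s) v_0 + s w] has one for almost all [s]. *)
Lemma cyclic_combination_closure r (x : 'rV[k]_(r.+1 * (3 * 3))) p a y :
  commuting_variety k r.+1 3 x ->
  cyclic_det y (\sum_i a i *: tuple_mx x i) != 0 ->
  vanish (range (@regular_point r)) p -> p.@[x 0] = 0.
Proof.
move=> /commuting_varietyP comm; set w := \sum_i _ => dy vp.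
pose v (t : unit -> k) := (1 - t tt) *: tuple_mx x ord0 + t tt *: w.
pose V t i := if i == ord0 then v t else tuple_mx x i.
have commw i : comm_mx (tuple_mx x i) w.
  apply: comm_mx_sum => j _.
  by rewrite /comm_mx -scalemxAl -scalemxAr comm.
have commv t i : v t *m tuple_mx x i = tuple_mx x i *m v t.
  apply: comm_mx_sym; apply: comm_mxD.
    by rewrite /comm_mx -scalemxAl -scalemxAr comm.
  by rewrite /comm_mx -scalemxAl -scalemxAr commw.
have pv : polymx v.
  apply: polymx_add; apply: polymx_scale; do ?exact: polymx_const.
    by apply: polyfun_sub; [apply: polyfun_const | apply: polyfun_var].
  exact: polyfun_var.
have pV : polymx (fun t => tuple_point (V t)).
  apply: polymx_tuple_point => i; rewrite /V; case: (i == _) => //.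
  exact: polymx_const.
have V0 : tuple_point (V (fun=> 0)) = x.
  rewrite -[RHS]tuple_mxK; congr tuple_point; apply/funext => i.
  by rewrite /V /v; case: eqP => [->|//]; rewrite subr0 scale1r scale0r addr0.
have v1 : v (fun=> 1) = w by rewrite /v subrr scale0r scale1r add0r.
apply: contrapT => /eqP; rewrite -V0 => px; rewrite -v1 in dy.
(* [p] is nonzero at parameter 0 and the cyclic determinant at 1. At a common good [t] the tuple
   consists of polynomials in [v t], so it lies in the regular image, where [p] vanishes. *)
have [t [pt dt]] := polyfun_identity (polyfun_meval p (pV 0))
  (polyfun_cyclic_det y pv) px dy.
have /choice[c Hc] i : exists c : 'I_3 -> k,
    tuple_mx x i = \sum_j c j *: v t ^+ j.
  exact: cyclic_commutant dt (commv t i).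
move/eqP: pt; apply; apply: vp.
pose s (j : regular_param r) := match j with
  | inl (l, j) => c (lift ord0 l) j
  | inr (a, b) => v t a b - nilpotent_shift a b end.
exists s => //; congr tuple_point; apply/funext => i.
have sE : regular_mx s = v t.
  by apply/matrixP => a' b; rewrite mxE [X in _ + X]mxE addrC subrK.
rewrite /regular_tuple /V sE; case: unliftP => [l ->|->]; last by rewrite eqxx.
by rewrite eq_sym (negPf (neq_lift _ _)) Hc.
Qed.

Definition dyad_param r : finType := (('I_3 + 'I_3) + ('I_r + 'I_r))%type.

Definition dyad_point r (t : dyad_param r -> k) : 'rV[k]_(r * (3 * 3)) :=
  tuple_point (fun i => (t (inr (inl i)))%:M + t (inr (inr i)) *:
    ((\row_j t (inl (inl j)))^T *m (\row_j t (inl (inr j))))).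

Lemma polymx_dyad_point r : polymx (@dyad_point r).
Proof.
apply: polymx_tuple_point => i; apply: polymx_add.
  by apply: polymx_scalar; apply: polyfun_var.
apply: polymx_scale; first exact: polyfun_var.
apply: polymx_mul; [apply: polymx_tr|]; apply: polymx_row => j;
  exact: polyfun_var.
Qed.

(** The common factor is computed as [cross p q] from the six coordinates of [p] and [q], which
    keeps the count at [3 * r + 6]. *)
Definition pencil_param r : finType :=
  (('I_3 + 'I_3) + ('I_r + ('I_r + 'I_r)))%type.

Section Pencil.
Variables (r : nat) (t : pencil_param r -> k) (i : 'I_r).
Let p : 'rV[k]_3 := \row_j t (inl (inl j)).
Let q : 'rV[k]_3 := \row_j t (inl (inr j)).

Definition pencil_scalar : k := t (inr (inl i)).
Definition pencil_normal : 'rV[k]_3 := cross p q.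
Definition pencil_vector : 'rV[k]_3 :=
  t (inr (inr (inl i))) *: p + t (inr (inr (inr i))) *: q.
End Pencil.

Definition column_point r (t : pencil_param r -> k) : 'rV[k]_(r * (3 * 3)) :=
  tuple_point (fun i => (pencil_scalar t i)%:M
    + (pencil_normal t)^T *m pencil_vector t i).

Definition row_point r (t : pencil_param r -> k) : 'rV[k]_(r * (3 * 3)) :=
  tuple_point (fun i => (pencil_scalar t i)%:M
    + (pencil_vector t i)^T *m pencil_normal t).

Lemma polymx_pencil_normal r : polymx (@pencil_normal r).
Proof.
by apply: polymx_cross; apply: polymx_row => j; apply: polyfun_var.
Qed.

Lemma polymx_pencil_vector r i : polymx (fun t => @pencil_vector r t i).
Proof.
apply: polymx_add; (apply: polymx_scale; first exact: polyfun_var);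
  by apply: polymx_row => j; apply: polyfun_var.
Qed.

Lemma polymx_column_point r : polymx (@column_point r).
Proof.
apply: polymx_tuple_point => i; apply: polymx_add.
  by apply: polymx_scalar; apply: polyfun_var.
apply: polymx_mul (polymx_pencil_vector i).
exact: polymx_tr (@polymx_pencil_normal r).
Qed.

Lemma polymx_row_point r : polymx (@row_point r).
Proof.
apply: polymx_tuple_point => i; apply: polymx_add.
  by apply: polymx_scalar; apply: polyfun_var.
apply: polymx_mul (@polymx_pencil_normal r).
exact: polymx_tr (polymx_pencil_vector i).
Qed.

(** Stated through vanishing polynomials because tuples of the cyclic type are only limits of
    regular points; the other three types lie in the images themselves. *)
Lemma commuting_variety_cover r p :
  vanish (range (@regular_point r) `|` (range (@dyad_point r.+1) `|`
    (range (@column_point r.+1) `|` range (@row_point r.+1)))) p ->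
  vanish (commuting_variety k r.+1 3) p.
Proof.
have rowK3 (u : 'rV[k]_3) : \row_j u 0 j = u.
  by apply/rowP => j; rewrite mxE.
move=> vp x Xx; move: (Xx) => /commuting_varietyP/commuting_classification[].
- move=> [a [y dy]]; apply: (cyclic_combination_closure Xx dy).
  by move=> z Sz; apply: vp; left.
- move=> [u [w [a [c H]]]]; apply: vp; right; left.
  exists (fun j => match j with
    | inl (inl j) => u 0 j | inl (inr j) => w 0 j
    | inr (inl i) => a i | inr (inr i) => c i end) => //.
  rewrite -[RHS]tuple_mxK; congr tuple_point; apply/funext => i.
  by rewrite !rowK3 H.
- move=> [u [w [a [b [c H]]]]]; apply: vp; right; right; left.
  exists (fun j => match j with
    | inl (inl j) => u 0 j | inl (inr j) => w 0 j
    | inr (inl i) => a i | inr (inr (inl i)) => b i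
    | inr (inr (inr i)) => c i end) => //.
  rewrite -[RHS]tuple_mxK; congr tuple_point; apply/funext => i.
  by rewrite /pencil_normal /pencil_vector !rowK3 H.
- move=> [u [w [a [b [c H]]]]]; apply: vp; right; right; right.
  exists (fun j => match j with
    | inl (inl j) => u 0 j | inl (inr j) => w 0 j
    | inr (inl i) => a i | inr (inr (inl i)) => b i
    | inr (inr (inr i)) => c i end) => //.
  rewrite -[RHS]tuple_mxK; congr tuple_point; apply/funext => i.
  by rewrite /pencil_normal /pencil_vector !rowK3 H.
Qed.

End CommutingTuples.

(** * Both bounds on the dimension of the commuting variety *)

Theorem corollary3p2p2 (k : closedFieldType) (hk : 3%N \notin [pchar k])
    (r : nat) (hr : (2 <= r)%N) :
  zariski_dim (commuting_variety k r 3) (3 * r + 6)%N.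
Proof.
case: r hr => // r _.
have card_regular : #|regular_param r| = (3 * r.+1 + 6)%N.
  by rewrite card_sum !card_prod !card_ord; lia.
have card_dyad : (#|dyad_param r.+1| <= 3 * r.+1 + 6)%N.
  by rewrite !card_sum !card_ord; lia.
have card_pencil : (#|pencil_param r.+1| <= 3 * r.+1 + 6)%N.
  by rewrite !card_sum !card_ord; lia.
split; first by rewrite -card_regular; apply: regular_chain.
move=> m chain; apply: chain_length_le chain _ => Z irrZ subZ.
have bound (I : finType) (phi : (I -> k) -> 'rV[k]_(r.+1 * (3 * 3))) :
    polymx phi -> (#|I| <= 3 * r.+1 + 6)%N ->
    (forall p, vanish (range phi) p -> vanish Z p) ->
    exists2 S, trdeg_le (3 * r.+1 + 6) S & forall p, vanish S p -> vanish Z p.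
  by move=> pphi Id sub; exists (range phi) => //; apply: trdeg_le_range pphi Id _.
(* [Z] lies in the closure of a union of four images; splitting off one at a time leaves a single
   image whose closure contains [Z]. *)
have cover p vp := vanishS subZ (@commuting_variety_cover k r p vp).
case: (irreducible_union irrZ cover) => [|{}cover].
  by apply: bound (@polymx_regular_point k r) _; rewrite card_regular.
case: (irreducible_union irrZ cover) => [|{}cover].
  exact: bound (@polymx_dyad_point k r.+1) card_dyad.
case: (irreducible_union irrZ cover).
  exact: bound (@polymx_column_point k r.+1) card_pencil.
exact: bound (@polymx_row_point k r.+1) card_pencil.
Qed.
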